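(* Let $P:\mathbb{C}\to\mathbb{D}$ be a discrete fibration. For each object $D$ of $\mathbb{D}$ let $P_D:(P\downarrow D)\to \mathbb{D}/D$ be the pullback of $P$ along $\operatorname{dom}:\mathbb{D}/D\to\mathbb{D}$ (so the domain of $P_D$ is the comma category $(P\downarrow D)$); $P_D$ is a discrete fibration over $\mathbb{D}/D$ and hence corresponds to a presheaf on $\mathbb{D}/D$. The following are equivalent: (1) for every $D\in\mathbb{D}$, the presheaf corresponding to $P_D$ is representable; (2) $P$ has a right adjoint; (3) $P$ is comonadic.
   Context: A discrete fibration over $\mathbb{D}$ corresponds (via the Grothendieck construction) to a presheaf on $\mathbb{D}$; it is called representable when the corresponding presheaf is representable. *)

(* Defs.v *)
From Stdlib Require Import ProofIrrelevance IndefiniteDescription.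

Record Category := {
  Ob : Type;
  Hom : Ob -> Ob -> Type;
  idm : forall A, Hom A A;
  comp : forall A B C, Hom B C -> Hom A B -> Hom A C;
  comp_idl : forall A B (f : Hom A B), comp A B B (idm B) f = f;
  comp_idr : forall A B (f : Hom A B), comp A A B f (idm A) = f;
  comp_assoc : forall A B C D (f : Hom A B) (g : Hom B C) (h : Hom C D),
      comp A C D h (comp A B C g f) = comp A B D (comp B C D h g) f }.
Arguments Ob : clear implicits.
Arguments Hom {c} _ _.
Arguments idm {c} A.
Arguments comp {c A B C} _ _.
Arguments comp_idl {c A B} f.
Arguments comp_idr {c A B} f.
Arguments comp_assoc {c A B C D} f g h.
Notation "g ∘ f" := (comp g f) (at level 40, left associativity).

Record Functor (C D : Category) := {
  fobj :> Ob C -> Ob D;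
  fmap : forall A B, @Hom C A B -> @Hom D (fobj A) (fobj B);
  fmap_id : forall A, fmap A A (idm A) = idm (fobj A);
  fmap_comp : forall A B E (f : Hom A B) (g : Hom B E),
      fmap A E (g ∘ f) = fmap B E g ∘ fmap A B f }.
Arguments fobj {C D} _ _.
Arguments fmap {C D} _ {A B} _.
Arguments fmap_id {C D} _ A.
Arguments fmap_comp {C D} _ {A B E} f g.

Definition Fid (C : Category) : Functor C C.
Proof.
  refine {| fobj := fun A => A; fmap := fun A B f => f |}; reflexivity.
Defined.

Definition Fcomp {C D E : Category} (G : Functor D E) (F : Functor C D) : Functor C E.
Proof.
  refine {| fobj := fun A => G (F A); fmap := fun A B f => fmap G (fmap F f) |}.
  - intro A; now rewrite !fmap_id.
  - intros; now rewrite !fmap_comp.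
Defined.

Record NatTrans {C D : Category} (F G : Functor C D) := {
  component :> forall A, Hom (F A) (G A);
  naturality : forall A B (f : Hom A B),
      component B ∘ fmap F f = fmap G f ∘ component A }.
Arguments component {C D F G} _ _.

Definition is_iso {C : Category} {A B : Ob C} (f : Hom A B) : Prop :=
  exists g : Hom B A, g ∘ f = idm A /\ f ∘ g = idm B.

Definition NatIso {C D : Category} (F G : Functor C D) : Prop :=
  exists alpha : NatTrans F G, forall A, is_iso (alpha A).

Definition is_equivalence {C D : Category} (K : Functor C D) : Prop :=
  exists L : Functor D C, NatIso (Fcomp K L) (Fid D) /\ NatIso (Fcomp L K) (Fid C).

Record Adjunction {C D : Category} (F : Functor C D) (G : Functor D C) := {
  adj_unit : forall c : Ob C, Hom c (G (F c));
  adj_counit : forall d : Ob D, Hom (F (G d)) d;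
  unit_nat : forall c c' (f : Hom c c'),
      adj_unit c' ∘ f = fmap G (fmap F f) ∘ adj_unit c;
  counit_nat : forall d d' (g : Hom d d'),
      g ∘ adj_counit d = adj_counit d' ∘ fmap F (fmap G g);
  triangle_l : forall c, adj_counit (F c) ∘ fmap F (adj_unit c) = idm (F c);
  triangle_r : forall d, fmap G (adj_counit d) ∘ adj_unit (G d) = idm (G d) }.
Arguments adj_unit {C D F G} _ _.
Arguments adj_counit {C D F G} _ _.
Arguments unit_nat {C D F G} _ {c c'} f.
Arguments triangle_l {C D F G} _ c.

Definition has_right_adjoint {C D : Category} (P : Functor C D) : Prop :=
  exists G : Functor D C, inhabited (Adjunction P G).

Lemma sig_eq {A : Type} {Q : A -> Prop} (x y : A) (px : Q x) (py : Q y) :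
  x = y -> exist Q x px = exist Q y py.
Proof. intros ->; f_equal; apply proof_irrelevance. Qed.

Section Comparison.
Context {C D : Category} {P : Functor C D} {G : Functor D C} (adj : Adjunction P G).

(* counit eps = adj_counit, comultiplication delta_X = P (eta_{G X}) *)
Definition is_coalg (X : Ob D) (s : Hom X (P (G X))) : Prop :=
  adj_counit adj X ∘ s = idm X /\
  fmap P (adj_unit adj (G X)) ∘ s = fmap P (fmap G s) ∘ s.

Definition coalg_ob : Type := {X : Ob D & {s : Hom X (P (G X)) | is_coalg X s}}.
Definition coalg_str (a : coalg_ob) : Hom (projT1 a) (P (G (projT1 a))) :=
  proj1_sig (projT2 a).

Definition coalg_hom (a b : coalg_ob) : Type :=
  {u : Hom (projT1 a) (projT1 b) | coalg_str b ∘ u = fmap P (fmap G u) ∘ coalg_str a}.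

Definition coalg_id (a : coalg_ob) : coalg_hom a a.
Proof.
  exists (idm _). now rewrite comp_idr, !fmap_id, comp_idl.
Defined.

Definition coalg_comp (a b c : coalg_ob) (v : coalg_hom b c) (u : coalg_hom a b) :
  coalg_hom a c.
Proof.
  exists (proj1_sig v ∘ proj1_sig u).
  destruct v as [v pv], u as [u pu]; simpl.
  rewrite comp_assoc, pv, <- comp_assoc, pu, comp_assoc.
  now rewrite <- !fmap_comp.
Defined.

Definition coalg_cat : Category.
Proof.
  refine {| Ob := coalg_ob; Hom := coalg_hom; idm := coalg_id; comp := coalg_comp |}.
  - intros A B [f pf]; apply sig_eq; simpl; apply comp_idl.
  - intros A B [f pf]; apply sig_eq; simpl; apply comp_idr.
  - intros A B C' D' [f pf] [g pg] [h ph]; apply sig_eq; simpl; apply comp_assoc.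
Defined.

Lemma comparison_is_coalg (c : Ob C) : is_coalg (P c) (fmap P (adj_unit adj c)).
Proof.
  split.
  - apply triangle_l.
  - now rewrite <- !fmap_comp, unit_nat.
Qed.

Definition comparison_ob (c : Ob C) : coalg_ob :=
  existT _ (P c) (exist _ (fmap P (adj_unit adj c)) (comparison_is_coalg c)).

Definition comparison_hom (c c' : Ob C) (g : Hom c c') :
  coalg_hom (comparison_ob c) (comparison_ob c').
Proof.
  exists (fmap P g); simpl.
  unfold coalg_str; simpl. now rewrite <- !fmap_comp, unit_nat.
Defined.

Definition comparison : Functor C coalg_cat.
Proof.
  refine {| fobj := comparison_ob : Ob C -> Ob coalg_cat;
            fmap := comparison_hom |}.
  - intro A; apply sig_eq; simpl; apply fmap_id.
  - intros; apply sig_eq; simpl; apply fmap_comp.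
Defined.
End Comparison.

Definition comonadic {C D : Category} (P : Functor C D) : Prop :=
  exists (G : Functor D C) (adj : Adjunction P G), is_equivalence (comparison adj).

Record Presheaf (B : Category) := {
  psh_ob :> Ob B -> Type;
  psh_map : forall x y, @Hom B x y -> psh_ob y -> psh_ob x;
  psh_map_id : forall x a, psh_map x x (idm x) a = a;
  psh_map_comp : forall x y z (f : Hom x y) (g : Hom y z) a,
      psh_map x z (g ∘ f) a = psh_map x y f (psh_map y z g a) }.
Arguments psh_ob {B} _ _.
Arguments psh_map {B} _ {x y} _ _.

Definition bijective {A B : Type} (f : A -> B) : Prop :=
  exists g : B -> A, (forall a, g (f a) = a) /\ (forall b, f (g b) = b).

Definition representable {B : Category} (F : Presheaf B) : Prop :=
  exists (b : Ob B) (alpha : forall x, Hom x b -> F x),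
    (forall x y (f : Hom x y) (h : Hom y b), alpha x (h ∘ f) = psh_map F f (alpha y h)) /\
    (forall x, bijective (alpha x)).

Definition arr {B : Category} {x y : Ob B} (f : Hom x y)
  : {xy : Ob B * Ob B & Hom (fst xy) (snd xy)} := existT _ (x, y) f.

Definition is_discrete_fibration {E B : Category} (P : Functor E B) : Prop :=
  forall (e : Ob E) (b : Ob B) (f : Hom b (P e)),
    (exists (e' : Ob E) (g : Hom e' e), arr (fmap P g) = arr f) /\
    (forall e1 (g1 : Hom e1 e) e2 (g2 : Hom e2 e),
        arr (fmap P g1) = arr f -> arr (fmap P g2) = arr f ->
        existT (fun x => Hom x e) e1 g1 = existT (fun x => Hom x e) e2 g2).

Lemma arr_comp {B : Category} {a b c a' b' c' : Ob B}
  (u : Hom b c) (v : Hom a b) (u' : Hom b' c') (v' : Hom a' b') :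
  arr u = arr u' -> arr v = arr v' -> arr (u ∘ v) = arr (u' ∘ v').
Proof.
  intros Hu Hv.
  pose proof (f_equal (@projT1 _ _) Hu) as H1; simpl in H1; injection H1; intros; subst.
  pose proof (f_equal (@projT1 _ _) Hv) as H2; simpl in H2; injection H2; intros; subst.
  apply inj_pair2 in Hu, Hv; subst; reflexivity.
Qed.

Definition castcod {B : Category} {x y y' : Ob B} (p : y = y') (f : Hom x y) : Hom x y' :=
  match p with eq_refl => f end.

Lemma arr_castcod {B : Category} {x y y' : Ob B} (p : y = y') (f : Hom x y) :
  arr (castcod p f) = arr f.
Proof. destruct p; reflexivity. Qed.

Section DFibPresheaf.
Context {E B : Category} {P : Functor E B} (H : is_discrete_fibration P).

Definition dfib_lift {e : Ob E} {b : Ob B} (f : Hom b (P e)) :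
  {l : {e' : Ob E & Hom e' e} | arr (fmap P (projT2 l)) = arr f}.
Proof.
  apply constructive_indefinite_description.
  destruct (proj1 (H e b f)) as [e' [g Hg]]. now exists (existT _ e' g).
Defined.

Definition fibre (b : Ob B) : Type := {e : Ob E | P e = b}.

Definition reindex (b b' : Ob B) (f : Hom b' b) (x : fibre b) : fibre b' :=
  match x with exist _ e p =>
    match dfib_lift (castcod (eq_sym p) f) with exist _ l Hl =>
      exist _ (projT1 l) (f_equal (fun a => fst (projT1 a)) Hl) end end.

Lemma reindex_id (b : Ob B) (x : fibre b) : reindex b b (idm b) x = x.
Proof.
  destruct x as [e p]; subst b; unfold reindex; simpl.
  destruct (dfib_lift (idm (P e))) as [[e' g] Hl]; simpl in *.
  apply sig_eq.
  assert (Hid : arr (fmap P (idm e)) = arr (idm (P e))) by now rewrite fmap_id.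
  pose proof (proj2 (H e (P e) (idm (P e))) e' g e (idm e) Hl Hid) as Heq.
  exact (f_equal (@projT1 _ _) Heq).
Qed.

Lemma reindex_comp (x y z : Ob B) (f : Hom x y) (g : Hom y z) (a : fibre z) :
  reindex z x (g ∘ f) a = reindex y x f (reindex z y g a).
Proof.
  destruct a as [e p]; subst z; unfold reindex at 2; simpl.
  destruct (dfib_lift g) as [[e1 g1] H1]; simpl in *.
  unfold reindex; simpl.
  match goal with |- context [dfib_lift (castcod ?q f)] =>
    generalize q; intro q1;
    destruct (dfib_lift (castcod q1 f)) as [[e2 g2] H2] end; simpl in *.
  destruct (dfib_lift (g ∘ f)) as [[e3 g3] H3]; simpl in *.
  apply sig_eq.
  assert (H4 : arr (fmap P (g1 ∘ g2)) = arr (g ∘ f)).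
  { rewrite fmap_comp. apply arr_comp; [exact H1|].
    rewrite H2. apply arr_castcod. }
  pose proof (proj2 (H e x (g ∘ f)) e3 g3 e2 (g1 ∘ g2) H3 H4) as Heq.
  exact (f_equal (@projT1 _ _) Heq).
Qed.

Definition dfib_presheaf : Presheaf B :=
  {| psh_ob := fibre; psh_map := fun x y f => reindex y x f;
     psh_map_id := reindex_id; psh_map_comp := reindex_comp |}.
End DFibPresheaf.

Section SliceComma.
Context {C D : Category} (P : Functor C D) (d : Ob D).

Definition slice_ob : Type := {X : Ob D & Hom X d}.
Definition slice_hom (a b : slice_ob) : Type :=
  {u : Hom (projT1 a) (projT1 b) | projT2 b ∘ u = projT2 a}.
Definition slice_id (a : slice_ob) : slice_hom a a :=
  exist _ (idm _) (comp_idr _).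
Definition slice_comp (a b c : slice_ob) (v : slice_hom b c) (u : slice_hom a b) :
  slice_hom a c.
Proof.
  exists (proj1_sig v ∘ proj1_sig u).
  destruct v as [v pv], u as [u pu]; simpl.
  now rewrite comp_assoc, pv, pu.
Defined.

Definition slice_cat : Category.
Proof.
  refine {| Ob := slice_ob; Hom := slice_hom; idm := slice_id; comp := slice_comp |}.
  - intros A B [f pf]; apply sig_eq; simpl; apply comp_idl.
  - intros A B [f pf]; apply sig_eq; simpl; apply comp_idr.
  - intros A B C' D' [f pf] [g pg] [h ph]; apply sig_eq; simpl; apply comp_assoc.
Defined.

Definition comma_ob : Type := {c : Ob C & Hom (P c) d}.
Definition comma_hom (a b : comma_ob) : Type :=
  {g : Hom (projT1 a) (projT1 b) | projT2 b ∘ fmap P g = projT2 a}.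
Definition comma_id (a : comma_ob) : comma_hom a a.
Proof. exists (idm _). now rewrite fmap_id, comp_idr. Defined.
Definition comma_comp (a b c : comma_ob) (v : comma_hom b c) (u : comma_hom a b) :
  comma_hom a c.
Proof.
  exists (proj1_sig v ∘ proj1_sig u).
  destruct v as [v pv], u as [u pu]; simpl.
  now rewrite fmap_comp, comp_assoc, pv, pu.
Defined.

Definition comma_cat : Category.
Proof.
  refine {| Ob := comma_ob; Hom := comma_hom; idm := comma_id; comp := comma_comp |}.
  - intros A B [f pf]; apply sig_eq; simpl; apply comp_idl.
  - intros A B [f pf]; apply sig_eq; simpl; apply comp_idr.
  - intros A B C' D' [f pf] [g pg] [h ph]; apply sig_eq; simpl; apply comp_assoc.
Defined.

Definition PD_ob (a : comma_ob) : slice_ob := existT _ (P (projT1 a)) (projT2 a).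
Definition PD_hom (a b : comma_ob) (g : comma_hom a b) : slice_hom (PD_ob a) (PD_ob b) :=
  exist _ (fmap P (proj1_sig g)) (proj2_sig g).

(** P_d : (P | d) -> D/d, the pullback of P along dom : D/d -> D *)
Definition P_over : Functor comma_cat slice_cat.
Proof.
  refine {| fobj := PD_ob : Ob comma_cat -> Ob slice_cat; fmap := PD_hom |}.
  - intro A; apply sig_eq; simpl; apply fmap_id.
  - intros; apply sig_eq; simpl; apply fmap_comp.
Defined.
End SliceComma.

Lemma P_over_dfib {C D : Category} (P : Functor C D) (HP : is_discrete_fibration P)
  (d : Ob D) : is_discrete_fibration (P_over P d).
Proof.
  intros [c h] [X x] [u pu]; simpl in *.
  set (F := fun (a : {xy : Ob (slice_cat d) * Ob (slice_cat d) &
                    Hom (fst xy) (snd xy)}) =>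
              existT (fun xy : Ob D * Ob D => Hom (fst xy) (snd xy))
                (projT1 (fst (projT1 a)), projT1 (snd (projT1 a)))
                (proj1_sig (projT2 a))).
  split.
  - destruct (proj1 (HP c X u)) as [c' [g Hg]].
    pose proof (f_equal (@projT1 _ _) Hg) as E1; simpl in E1; injection E1; intros; subst X.
    apply inj_pair2 in Hg; subst u. subst x.
    exists (existT _ c' (h ∘ fmap P g) : Ob (comma_cat P d)).
    exists (exist _ g eq_refl : @Hom (comma_cat P d) (existT _ c' (h ∘ fmap P g)) (existT _ c h)).
    reflexivity.
  - intros [c1 h1] [g1 p1] [c2 h2] [g2 p2] E1 E2; simpl in *.
    pose proof (f_equal F E1) as F1; pose proof (f_equal F E2) as F2.
    unfold F in F1, F2; simpl in F1, F2.
    pose proof (proj2 (HP c X u) c1 g1 c2 g2 F1 F2) as Heq.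
    pose proof (f_equal (@projT1 _ _) Heq) as Ec; simpl in Ec; subst c2.
    apply inj_pair2 in Heq; subst g2. subst h1 h2.
    reflexivity.
Qed.

(* Main.v *)
(* Unique lifting makes a discrete fibration P faithful, and a representing
   element of the presheaf of P_D is the same thing as a terminal object of the
   comma category (P ↓ D): lifting the identity of its representing object
   produces one.  A choice of terminal objects of all (P ↓ D) is the usual
   pointwise description of a right adjoint G.  Given P ⊣ G, a coalgebra
   s : X → P G X lifts along P to some g : c → G X with P c = X; the counit law
   forces g to be the unit at c, so every coalgebra is literally the image of c
   under the comparison functor, and unique lifting also makes that functor
   full. *)

Require Import Defs.
From Stdlib Require Import ProofIrrelevance IndefiniteDescription.

Arguments triangle_r {C D F G} _ d.
Arguments counit_nat {C D F G} _ {d d'} g.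

Lemma arr_inj {B : Category} {x y : Ob B} (f f' : Hom x y) : arr f = arr f' -> f = f'.
Proof. apply inj_pair2. Qed.

Lemma is_iso_idm {B : Category} (b : Ob B) : is_iso (idm b).
Proof. exists (idm b); split; apply comp_idl. Qed.

Definition is_terminal (E : Category) (t : Ob E) : Prop :=
  forall e, inhabited (Hom e t) /\ forall g1 g2 : Hom e t, g1 = g2.

Definition terminal_hom {E : Category} {t : Ob E} (Ht : is_terminal E t) (e : Ob E) :
  Hom e t.
Proof.
  apply (proj1_sig (P := fun _ => True)), constructive_indefinite_description.
  destruct (proj1 (Ht e)) as [g]; now exists g.
Defined.

Section DiscreteFibration.
Context {E B : Category} {Q : Functor E B} (HQ : is_discrete_fibration Q).

Lemma dfib_faithful a a' (g g' : Hom a a') : fmap Q g = fmap Q g' -> g = g'.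
Proof.
  intro Eg.
  assert (Earr : arr (fmap Q g') = arr (fmap Q g)) by now rewrite Eg.
  exact (inj_pair2 _ _ _ _ _ (proj2 (HQ a' (Q a) (fmap Q g)) a g a g' eq_refl Earr)).
Qed.

Lemma reindex_fmap (e e' : Ob E) (g : Hom e' e) :
  reindex HQ (Q e) (Q e') (fmap Q g) (exist _ e eq_refl) = exist _ e' eq_refl.
Proof.
  unfold reindex; simpl.
  destruct (dfib_lift HQ (fmap Q g)) as [[e1 g1] Hl]; simpl in *.
  apply sig_eq.
  exact (f_equal (@projT1 _ _) (proj2 (HQ e (Q e') (fmap Q g)) e1 g1 e' g Hl eq_refl)).
Qed.

Lemma reindex_lifts (t : Ob E) (b : Ob B) (u : Hom b (Q t)) :
  exists e (p : Q e = b) (g : Hom e t),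
    reindex HQ (Q t) b u (exist _ t eq_refl) = exist _ e p /\ arr (fmap Q g) = arr u.
Proof.
  unfold reindex; simpl.
  destruct (dfib_lift HQ u) as [[e g] Hl]; simpl in *.
  eexists e, _, g; split; [reflexivity | exact Hl].
Qed.

Lemma representable_terminal :
  representable (dfib_presheaf HQ) -> exists t, is_terminal E t.
Proof.
  intros [b [alpha [alpha_nat alpha_bij]]].
  assert (yoneda : forall x h, alpha x h = reindex HQ b x h (alpha b (idm b))).
  { intros x h. rewrite <- (comp_idl h) at 1. apply alpha_nat. }
  destruct (alpha b (idm b)) as [t pt]. subst b.
  exists t; intro e; split.
  - destruct (alpha_bij (Q e)) as [alpha_inv [_ alpha_inv_r]].
    pose proof (alpha_inv_r (exist _ e eq_refl)) as Hu.
    rewrite yoneda in Hu.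
    destruct (reindex_lifts t (Q e) (alpha_inv (exist _ e eq_refl)))
      as [e' [p [g [Hreindex _]]]].
    rewrite Hreindex in Hu.
    injection Hu as ->. now constructor.
  - intros g1 g2. apply dfib_faithful.
    destruct (alpha_bij (Q e)) as [alpha_inv [alpha_inv_l _]].
    rewrite <- (alpha_inv_l (fmap Q g1)), <- (alpha_inv_l (fmap Q g2)), !yoneda,
      !reindex_fmap.
    reflexivity.
Qed.

Lemma terminal_representable (t : Ob E) :
  is_terminal E t -> representable (dfib_presheaf HQ).
Proof.
  intro Ht.
  exists (Q t), (fun x h => reindex HQ (Q t) x h (exist _ t eq_refl)); split.
  - intros x y f h. apply reindex_comp.
  - intro x.
    exists (fun a : fibre x => match proj2_sig a in _ = y return Hom y (Q t) with
                       eq_refl => fmap Q (terminal_hom Ht (proj1_sig a)) end).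
    split.
    + intro h. destruct (reindex_lifts t x h) as [e [p [g [-> Hg]]]].
      subst x; simpl.
      rewrite (proj2 (Ht e) (terminal_hom Ht e) g). now apply arr_inj.
    + intros [e p]. subst x. apply reindex_fmap.
Qed.

Lemma representable_iff_terminal :
  representable (dfib_presheaf HQ) <-> exists t, is_terminal E t.
Proof.
  split; [apply representable_terminal | intros [t Ht]; exact (terminal_representable t Ht)].
Qed.
End DiscreteFibration.

Lemma adj_transposeK {C D : Category} {P : Functor C D} {G : Functor D C}
  (adj : Adjunction P G) c d (g : Hom c (G d)) :
  g = fmap G (adj_counit adj d ∘ fmap P g) ∘ adj_unit adj c.
Proof.
  rewrite fmap_comp, <- comp_assoc, <- unit_nat, comp_assoc, triangle_r, comp_idl.
  reflexivity.
Qed.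

Lemma adj_counit_terminal {C D : Category} {P : Functor C D} {G : Functor D C}
  (adj : Adjunction P G) d :
  is_terminal (comma_cat P d) (existT _ (G d) (adj_counit adj d)).
Proof.
  intros [c h]; split.
  - constructor. exists (fmap G h ∘ adj_unit adj c). simpl.
    rewrite fmap_comp, comp_assoc, <- counit_nat, <- comp_assoc, triangle_l, comp_idr.
    reflexivity.
  - intros [g1 p1] [g2 p2]. apply sig_eq. cbn in *.
    rewrite (adj_transposeK adj _ _ g1), (adj_transposeK adj _ _ g2).
    change (adj_counit adj d ∘ fmap P g1 = h) in p1.
    change (adj_counit adj d ∘ fmap P g2 = h) in p2.
    now rewrite p1, p2.
Qed.

Section RightAdjointOfTerminals.
Context {C D : Category} (P : Functor C D) (t : forall d, Ob (comma_cat P d))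
  (Ht : forall d, is_terminal (comma_cat P d) (t d)).

Definition radj_ob (d : Ob D) : Ob C := projT1 (t d).
Definition radj_counit (d : Ob D) : Hom (P (radj_ob d)) d := projT2 (t d).

Definition radj_transpose c d (h : Hom (P c) d) : Hom c (radj_ob d) :=
  proj1_sig (terminal_hom (Ht d) (existT _ c h)).

Lemma radj_transposeE c d (h : Hom (P c) d) :
  radj_counit d ∘ fmap P (radj_transpose c d h) = h.
Proof. exact (proj2_sig (terminal_hom (Ht d) (existT _ c h))). Qed.

Lemma radj_transpose_uniq c d (h : Hom (P c) d) (g : Hom c (radj_ob d)) :
  radj_counit d ∘ fmap P g = h -> g = radj_transpose c d h.
Proof.
  intro Hg.
  exact (f_equal (@proj1_sig _ _)
    (proj2 (Ht d (existT _ c h)) (exist _ g Hg) (terminal_hom (Ht d) (existT _ c h)))).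
Qed.

Definition radj : Functor D C.
Proof.
  refine {| fobj := radj_ob;
            fmap := fun d d' f => radj_transpose (radj_ob d) d' (f ∘ radj_counit d) |}.
  - intro d. symmetry. apply radj_transpose_uniq.
    now rewrite fmap_id, comp_idr, comp_idl.
  - intros d d' d'' f g. symmetry. apply radj_transpose_uniq.
    rewrite fmap_comp, comp_assoc, radj_transposeE, <- comp_assoc, radj_transposeE.
    apply comp_assoc.
Defined.

Definition radj_adjunction : Adjunction P radj.
Proof.
  refine (Build_Adjunction _ _ P radj (fun c => radj_transpose c (P c) (idm (P c)))
            radj_counit _ _ _ _).
  - intros c c' f. simpl. transitivity (radj_transpose c (P c') (fmap P f)).
    + apply radj_transpose_uniq.
      now rewrite fmap_comp, comp_assoc, radj_transposeE, comp_idl.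
    + symmetry. apply radj_transpose_uniq.
      rewrite fmap_comp, comp_assoc, radj_transposeE, <- comp_assoc, radj_transposeE.
      apply comp_idr.
  - intros d d' g. simpl. now rewrite radj_transposeE.
  - intro c. apply radj_transposeE.
  - intro d. simpl. transitivity (radj_transpose (radj_ob d) d (radj_counit d)).
    + apply radj_transpose_uniq.
      rewrite fmap_comp, comp_assoc, radj_transposeE, <- comp_assoc, radj_transposeE.
      apply comp_idr.
    + symmetry. apply radj_transpose_uniq. now rewrite fmap_id, comp_idr.
Defined.
End RightAdjointOfTerminals.

Lemma has_right_adjoint_iff_comma_terminal {C D : Category} (P : Functor C D) :
  has_right_adjoint P <-> forall d, exists t, is_terminal (comma_cat P d) t.
Proof.
  split.
  - intros [G [adj]] d. eexists. apply (adj_counit_terminal adj).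
  - intro Ht.
    pose (t := fun d => proj1_sig (constructive_indefinite_description _ (Ht d))).
    exists (radj P t (fun d => proj2_sig (constructive_indefinite_description _ (Ht d)))).
    constructor. apply radj_adjunction.
Qed.

Section FullyFaithfulEssSurj.
Context {A B : Category} (K : Functor A B)
  (K_faithful : forall a a' (g g' : Hom a a'), fmap K g = fmap K g' -> g = g')
  (K_full : forall a a' (u : Hom (K a) (K a')), exists g, fmap K g = u)
  (K_ess_surj : forall b, exists a (f : Hom (K a) b), is_iso f).

Let ess_pre b := constructive_indefinite_description _ (K_ess_surj b).
Let inv_ob b : Ob A := proj1_sig (ess_pre b).
Let ess_iso b := constructive_indefinite_description _ (proj2_sig (ess_pre b)).
Let iso b : Hom (K (inv_ob b)) b := proj1_sig (ess_iso b).
Let iso_inv_spec b := constructive_indefinite_description _ (proj2_sig (ess_iso b)).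
Let iso_inv b : Hom b (K (inv_ob b)) := proj1_sig (iso_inv_spec b).

Lemma iso_invK b : iso_inv b ∘ iso b = idm _.
Proof. exact (proj1 (proj2_sig (iso_inv_spec b))). Qed.
Lemma iso_isoK b : iso b ∘ iso_inv b = idm _.
Proof. exact (proj2 (proj2_sig (iso_inv_spec b))). Qed.

Let preim a a' (u : Hom (K a) (K a')) : Hom a a' :=
  proj1_sig (constructive_indefinite_description _ (K_full a a' u)).
Lemma fmap_preim a a' u : fmap K (preim a a' u) = u.
Proof. exact (proj2_sig (constructive_indefinite_description _ (K_full a a' u))). Qed.

Definition ffes_inverse : Functor B A.
Proof.
  refine {| fobj := inv_ob; fmap := fun b b' f => preim _ _ (iso_inv b' ∘ f ∘ iso b) |}.
  - intro b. apply K_faithful. rewrite fmap_preim, fmap_id, comp_idr. apply iso_invK.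
  - intros b b' b'' f g. apply K_faithful. rewrite fmap_comp, !fmap_preim.
    rewrite !comp_assoc, <- (comp_assoc (iso_inv b') (iso b')), iso_isoK, comp_idr.
    reflexivity.
Defined.

Lemma ffes_equivalence : is_equivalence K.
Proof.
  exists ffes_inverse. split.
  - unshelve eexists.
    + refine {| component := (iso : forall b, Hom (Fcomp K ffes_inverse b) (Fid B b)) |}.
      intros b b' f. simpl. now rewrite fmap_preim, !comp_assoc, iso_isoK, comp_idl.
    + intro b. exists (iso_inv b). split; [apply iso_invK | apply iso_isoK].
  - unshelve eexists.
    + refine {| component := (fun a => preim _ _ (iso (K a))
                              : Hom (Fcomp ffes_inverse K a) (Fid A a)) |}.
      intros a a' g. simpl. apply K_faithful. rewrite !fmap_comp, !fmap_preim.
      now rewrite !comp_assoc, iso_isoK, comp_idl.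
    + intro a. simpl. exists (preim _ _ (iso_inv (K a))).
      split; apply K_faithful; rewrite fmap_comp, !fmap_preim, fmap_id;
        [apply iso_invK | apply iso_isoK].
Qed.
End FullyFaithfulEssSurj.

Section Comparison.
Context {C D : Category} {P : Functor C D} {G : Functor D C} (adj : Adjunction P G)
  (HP : is_discrete_fibration P).

Lemma comparison_faithful a a' (g g' : Hom a a') :
  fmap (comparison adj) g = fmap (comparison adj) g' -> g = g'.
Proof. intro Eg. apply (dfib_faithful HP). exact (f_equal (@proj1_sig _ _) Eg). Qed.

(* A coalgebra morphism [u] and a lift [g] of it give two lifts of
   [P η ∘ u], namely [η ∘ g] and [G u ∘ η]; uniqueness forces [g] to start at [a]. *)
Lemma comparison_full a a' (u : Hom (comparison adj a) (comparison adj a')) :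
  exists g, fmap (comparison adj) g = u.
Proof.
  destruct u as [u0 pu]. cbn in *.
  destruct (proj1 (HP a' (P a) u0)) as [c [g Hg]].
  assert (lift1 : arr (fmap P (adj_unit adj a' ∘ g)) = arr (fmap P (adj_unit adj a') ∘ u0)).
  { rewrite fmap_comp. apply arr_comp; [reflexivity | exact Hg]. }
  assert (lift2 : arr (fmap P (fmap G u0 ∘ adj_unit adj a))
                  = arr (fmap P (adj_unit adj a') ∘ u0)).
  { rewrite fmap_comp. unfold coalg_str in pu. cbn in pu. now rewrite pu. }
  pose proof (proj2 (HP (G (P a')) (P a) (fmap P (adj_unit adj a') ∘ u0))
                c _ a _ lift1 lift2) as Hc.
  injection Hc as ->.
  exists g. apply sig_eq. now apply arr_inj.
Qed.

Lemma comparison_surj (b : Ob (coalg_cat adj)) : exists a, comparison adj a = b.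
Proof.
  destruct b as [X [s [counit_law coassoc_law]]].
  destruct (proj1 (HP (G X) X s)) as [c [g Hg]].
  injection (f_equal (@projT1 _ _) Hg) as <-.
  apply arr_inj in Hg.
  assert (g_unit : g = adj_unit adj c).
  { now rewrite (adj_transposeK adj _ _ g), Hg, counit_law, fmap_id, comp_idl. }
  subst s g.
  exists c. simpl. unfold comparison_ob. f_equal. now apply sig_eq.
Qed.

Lemma comparison_equivalence : is_equivalence (comparison adj).
Proof.
  apply ffes_equivalence; [exact comparison_faithful | exact comparison_full |].
  intro b. destruct (comparison_surj b) as [a <-].
  exists a, (idm _). apply is_iso_idm.
Qed.
End Comparison.

Theorem mainTheorem1 (C D : Category) (P : Functor C D)
  (HP : is_discrete_fibration P) :
  ((forall d : Ob D, representable (dfib_presheaf (P_over_dfib P HP d)))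
     <-> has_right_adjoint P) /\
  (has_right_adjoint P <-> comonadic P).
Proof.
  split.
  - rewrite has_right_adjoint_iff_comma_terminal.
    split; intros H d; apply (representable_iff_terminal (P_over_dfib P HP d)), H.
  - split.
    + intros [G [adj]]. exists G, adj. exact (comparison_equivalence adj HP).
    + intros [G [adj _]]. exists G. now constructor.
Qed.
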